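(* Let $p\geq 3$ be a prime number, let $m\geq 1$ be an integer, and let $f(t)\in\mathbb{Q}[t]$ be an irreducible polynomial over $\mathbb{Q}$ of degree $d=2p^m$ with roots $\alpha_1,\alpha_2,\dots,\alpha_d$. Then, for any linear relation $\sum_{j=1}^d a_j\alpha_j=0$ with coefficients $a_j\in\mathbb{Z}$ that satisfy $\sum_{j=1}^d |a_j|<p$, the sum $\sum_{j=1}^d a_j$ is even.
   Context: Roots are taken in $\mathbb{C}$ (equivalently, in an algebraic closure of $\mathbb{Q}$); $\alpha_1,\dots,\alpha_d$ lists all $d$ distinct roots of $f$, each exactly once. *)

(* Defs.v *)
From mathcomp Require Import all_boot all_order all_algebra all_field.

Set Implicit Arguments.
Unset Strict Implicit.
Unset Printing Implicit Defensive.

Import GRing.Theory.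
Local Open Scope ring_scope.

(* alpha lists all the complex roots of f, each exactly once; algC, an algebraic
   closure of rat, contains every complex root of f. *)
Definition lists_roots (f : {poly rat}) (d : nat) (alpha : 'I_d -> algC) : Prop :=
  injective alpha /\
  forall z : algC, root (map_poly ratr f) z <-> exists j : 'I_d, alpha j = z.

(* Main.v *)
From HB Require Import structures.
Require Import Defs.
From mathcomp Require Import all_boot all_order all_algebra.
From mathcomp Require Import all_fingroup all_solvable all_field ring.

Set Implicit Arguments.
Unset Strict Implicit.
Unset Printing Implicit Defensive.

Import Order.TTheory GRing.Theory Num.Theory.
Local Open Scope group_scope.
Local Open Scope ring_scope.

(* Suppose a relation a with small coefficients has odd sum s, and let P be a
   Sylow p-subgroup of the Galois group G: it has exactly two orbits O1, O2 on
   the roots, both of size p^m. A Q-linear functional, scaled to be primitive at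
   p and reduced mod p, gives a nonzero phi : roots -> F_p orthogonal to every
   Galois translate of a. The phi with this property form a nonzero P-stable
   F_p-space, so one of them is fixed by the p-group P, i.e. equal to constants
   c1 on O1 and c2 on O2. Writing s1(g) for the sum over O1 of the translate
   of a by g, this says (c1 - c2) s1(g) + c2 s = 0 mod p. As s is odd and
   |s| < p, s <> 0 mod p, so c1 <> c2 and s1(g) mod p does not depend on g; since
   |2 s1(g) - s| < p, neither does the integer s1(g). Averaging over the
   transitive group G yields s1(g) = s / 2, a contradiction. *)

(** Multiplicative view of the additive group, so that p-group theory applies to spaces of
    functions. *)
HB.instance Definition _ (T : finType) (R : finZmodType) :=
  Finite_isGroup.Build {ffun T -> R} (@addrA _) (@add0r _) (@addNr _).

(** * Sylow orbits, fixed vectors and averaging for group actions *)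

Section Action.
Variables (gT : finGroupType) (T : finType) (to : {action gT &-> T}).
Variables (p : nat) (G P : {group gT}).

(** Compare the orbit-stabilizer formulas of [G] and [P]: the stabilizer of [x] in [P] is a p-group,
    so its order divides the p-part of the order of the stabilizer in [G]. *)
Lemma dvdn_Sylow_orbit (S : {set T}) x :
  [transitive G, on S | to] -> x \in S -> p.-Sylow(G) P ->
  (#|S|`_p %| #|orbit to P x|)%N.
Proof.
move=> trG Sx sylP; have sPG := pHall_sub sylP.
have cardG : #|G| = (#|S| * #|'C_G[x | to]|)%N.
  by rewrite -(card_orbit_stab to G x) (atransP trG).
have Px_Gx : (#|'C_P[x | to]| %| #|'C_G[x | to]|`_p)%N.
  rewrite -(part_pnat_id (pgroupS (subsetIl P _) (pHall_pgroup sylP))).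
  by apply: partn_dvd; rewrite ?cardG_gt0 ?cardSg ?setSI.
have := card_Hall sylP.
rewrite cardG partnM ?cardG_gt0 //; last first.
  by rewrite lt0n cards_eq0; apply/set0Pn; exists x.
rewrite -(card_orbit_stab to P x); case/dvdnP: Px_Gx => k ->.
rewrite mulnA => /eqP; rewrite eqn_pmul2r ?cardG_gt0 // => /eqP ->.
exact: dvdn_mulr.
Qed.

(** The number of fixed points of [P] in [V] is congruent to [#|V|], hence to 0, mod p; as 0 is
    fixed, it is not the only fixed point. *)
Lemma pgroup_fixed_ffun (V : {set {ffun T -> 'F_p}}) phi :
  prime p -> p.-group P -> zmod_closed V -> phi \in V -> phi != 0 ->
  (forall psi g, psi \in V -> g \in P -> [ffun x => psi (to x g)] \in V) ->
  exists psi : {ffun T -> 'F_p},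
    [/\ psi \in V, psi != 0 & forall x g, g \in P -> psi (to x g) = psi x].
Proof.
move=> p_pr pP [V0 VB] Vphi nz_phi VP.
(* The inverse makes precomposition a right action. *)
pose act (psi : {ffun T -> 'F_p}) g : {ffun T -> 'F_p} :=
  [ffun x => psi (to x g^-1%g)].
have a1 : act^~ 1%g =1 id.
  by move=> psi; apply/ffunP=> x; rewrite ffunE invg1 act1.
have aM psi : act_morph act psi.
  by move=> g h; apply/ffunP=> x; rewrite !ffunE invMg actM.
pose toV := TotalAction a1 aM.
have actsV : [acts P, on V | toV].
  apply/subsetP=> g Pg; rewrite !inE; apply/subsetP=> psi Vpsi.
  by rewrite inE; apply: VP; rewrite ?groupV.
have p_dvd_V : (p %| #|V|)%N.
  have gV : group_set V.
    apply/group_setP; split=> // u v Vu Vv.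
    by rewrite -[(u * v)%g]/(u + v) -[v]opprK -[- v]sub0r VB ?VB.
  have pV : p.-group (Group gV).
    apply: pgroupS (subsetT _) _; rewrite /pgroup cardsT card_ffun card_Fp //.
    by rewrite pnatX pnat_id.
  have [[|k] /= cardV] := p_natP pV; last by rewrite cardV expnS dvdn_mulr.
  have /cards1P[u Vu] : #|V| == 1%N by rewrite cardV.
  by move: nz_phi V0 Vphi; rewrite Vu !inE => /negPf nz /eqP <-; rewrite nz.
have fixV0 : 0 \in 'Fix_(V | toV)(P).
  rewrite in_setI V0; apply/afixP=> g _; by apply/ffunP=> x; rewrite !ffunE.
have /subsetPn[psi] :
    ~~ ('Fix_(V | toV)(P) \subset [set (0 : {ffun T -> 'F_p})]).
  apply/negP; rewrite subset1 => /orP[]/eqP fixV.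
    have := pgroup_fix_mod pP actsV.
    by rewrite fixV cards1 (eqP p_dvd_V) modn_small ?prime_gt1.
  by rewrite fixV inE in fixV0.
rewrite in_setI in_set1 => /andP[Vpsi /afixP fix_psi] nz_psi.
exists psi; split=> // x g Pg.
by rewrite -{2}(fix_psi _ (groupVr Pg)) ffunE invgK.
Qed.

(** By transitivity the sum of [a (to x g)] over [g] is the same for every [x]. The factor [#|T|]
    avoids a division. *)
Lemma sum_transitive (R : nmodType) (a : T -> R) (O : {set T}) :
  [transitive G, on setT | to] ->
  (\sum_(g in G) \sum_(x in O) a (to x g)) *+ #|T|
    = (\sum_x a x) *+ (#|O| * #|G|).
Proof.
move=> trG.
transitivity (\sum_(x in O) (\sum_y a y) *+ #|G|); last first.
  by rewrite sumr_const -mulrnA mulnC.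
rewrite exchange_big /= -sumrMnl; apply: eq_bigr => x _.
have E y : \sum_(g in G) a (to y g) = \sum_(g in G) a (to x g).
  have [h Gh ->] := atransP2 trG (in_setT x) (in_setT y).
  rewrite [RHS](reindex_inj (mulgI h)) /=.
  by apply: eq_big => [g | g _]; rewrite ?groupMl // actM.
transitivity (\sum_y \sum_(g in G) a (to y g)).
  by rewrite (eq_bigr _ (fun y _ => E y)) sumr_const.
rewrite exchange_big /= -sumr_const; apply: eq_bigr => g _.
by rewrite [RHS](reindex_inj (act_inj to g)).
Qed.
End Action.

(** * The combinatorial core *)

Lemma even_sum_of_annihilator (gT : finGroupType) (T : finType)
    (to : {action gT &-> T}) (p m : nat) (a : T -> int)
    (phi : {ffun T -> 'F_p}) :
  prime p -> (2 < p)%N -> #|T| = (2 * p ^ m)%N ->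
  [transitive [set: gT], on setT | to] ->
  phi != 0 ->
  (forall g, \sum_x (a (to x g))%:~R * phi x = 0) ->
  \sum_x `|a x| < p%:Z -> (2 %| \sum_x a x)%Z.
Proof.
move=> p_pr p_gt2 T_card trG nz_phi phi_a a_lt.
have [P sylP] := Sylow_exists p [set: gT].
have pP := pHall_pgroup sylP.
have chp := pchar_Fp p_pr.
(* The size is a power of p divisible by p^m; a larger power would be at least p * p^m, which
   exceeds [#|T|] because 2 < p. *)
have card_orb x : #|orbit to P x| = (p ^ m)%N.
  have := dvdn_Sylow_orbit trG (in_setT x) sylP.
  have Tp : (#|[set: T]|`_p = p ^ m)%N.
    rewrite cardsT T_card partnM ?expn_gt0 ?prime_gt0 //.
    rewrite part_p'nat ?mul1n ?part_pnat_id ?pnatX ?pnat_id //.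
    by rewrite p'natE // gtnNdvd.
  have orb_le : (#|orbit to P x| <= 2 * p ^ m)%N by rewrite -T_card max_card.
  have /p_natP[k Dk] : p.-nat #|orbit to P x|
    by apply: pnat_dvd pP; apply: dvdn_orbit.
  rewrite Tp Dk dvdn_Pexp2l ?prime_gt1 // leq_eqVlt => /predU1P[-> // | lt_mk].
  move: orb_le; rewrite leqNgt Dk; case/negP.
  apply: leq_trans (_ : p ^ m.+1 <= _)%N; last by rewrite leq_pexp2l ?prime_gt0.
  by rewrite expnS ltn_pmul2r // expn_gt0 prime_gt0.
pose V := [set psi : {ffun T -> 'F_p} |
           [forall g, \sum_x (a (to x g))%:~R * psi x == 0]].
have VP psi g : psi \in V -> \sum_x (a (to x g))%:~R * psi x = 0.
  by rewrite inE => /forallP/(_ g)/eqP.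
have V_zmod : zmod_closed V.
  split=> [|u v Vu Vv]; rewrite inE; apply/forallP=> g; apply/eqP.
    by rewrite big1 // => x _; rewrite ffunE mulr0.
  under eq_bigr do rewrite !ffunE mulrBr.
  by rewrite sumrB !VP ?subr0.
have Vphi : phi \in V by rewrite inE; apply/forallP=> g; apply/eqP.
have V_P psi g : psi \in V -> g \in P -> [ffun x => psi (to x g)] \in V.
  move=> Vpsi _; rewrite inE; apply/forallP=> h; apply/eqP.
  (* Substituting [to x g] for [x] moves the shift from [psi] to [a], and [V] allows every translate
     of [a]. *)
  rewrite -[RHS](VP psi (g^-1 * h)%g Vpsi) [RHS](reindex_inj (act_inj to g)).
  by apply: eq_bigr => x _; rewrite ffunE actM actK.
have [psi [Vpsi nz_psi psiP]] :=
  pgroup_fixed_ffun p_pr pP V_zmod Vphi nz_phi V_P.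
have /card_gt0P[x0 _] : (0 < #|T|)%N.
  by rewrite T_card muln_gt0 expn_gt0 (prime_gt0 p_pr).
pose O1 := orbit to P x0.
have [y0 O1'y0] : exists y0, y0 \in ~: O1.
  apply/card_gt0P; rewrite cardsCs setCK T_card card_orb mul2n -addnn addnK.
  by rewrite expn_gt0 prime_gt0.
have O2E : orbit to P y0 = ~: O1.
  apply/eqP; rewrite eqEcard cardsCs setCK T_card !card_orb mul2n -addnn.
  rewrite addnK leqnn andbT.
  apply/subsetP=> z /orbit_eqP Dz; rewrite inE.
  apply: contraL O1'y0 => /orbit_eqP Dz'.
  by rewrite inE negbK /O1 -Dz' Dz orbit_refl.
have psi1 x : x \in O1 -> psi x = psi x0 by case/imsetP=> g Pg ->; apply: psiP.
have psi2 x : x \notin O1 -> psi x = psi y0.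
  by rewrite -in_setC -O2E; case/imsetP=> g Pg ->; apply: psiP.
pose s := \sum_x a x.
pose s1 g := \sum_(x in O1) a (to x g).
pose s2 g := \sum_(x | x \notin O1) a (to x g).
have s12 g : s1 g + s2 g = s.
  by rewrite /s (reindex_inj (act_inj to g)) /= (bigID (mem O1)).
have rel g : (psi x0 - psi y0) * (s1 g)%:~R + psi y0 * s%:~R = 0.
  rewrite -(VP psi g Vpsi) (bigID (mem O1)) /=.
  rewrite -(s12 g) intrD mulrDr addrA mulrBl subrK !rmorph_sum !mulr_sumr.
  by congr (_ + _); apply: eq_bigr => x Ox;
    rewrite mulrC ?(psi1 x Ox) ?(psi2 x Ox).
have small_mod (z : int) : `|z| < p%:Z -> z%:~R = 0 :> 'F_p -> z = 0.
  move=> z_lt /eqP; rewrite -(dvdz_pcharf chp) dvdzE /= => p_z.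
  apply/eqP; rewrite -absz_eq0; move: p_z; apply: contraTT.
  rewrite -lt0n => z_gt0.
  by rewrite gtnNdvd // -ltz_nat abszE.
apply: contraT => s_odd.
have s_lt : `|s| < p%:Z := le_lt_trans (ler_norm_sum _ _ _) a_lt.
have nz_s : s%:~R != 0 :> 'F_p.
  apply: contraNneq s_odd => /(small_mod _ s_lt).
  by rewrite /s => ->; rewrite dvdz0.
have nz_c : psi x0 - psi y0 != 0.
  apply: contra_neq nz_psi => c0; have := rel 1%g; rewrite c0 mul0r add0r.
  move/eqP; rewrite mulf_eq0 (negPf nz_s) orbF => /eqP y0_0.
  have x0_0 : psi x0 = 0 by rewrite -(subrK (psi y0) (psi x0)) c0 y0_0 add0r.
  apply/ffunP=> x; rewrite [RHS]ffunE.
  by have [/psi1-> | /psi2->] := boolP (x \in O1).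
(* This difference is [2 * s1 g - s]: two values of [2 * s1] differ by less than 2p, so two values
   of [s1] by less than p, and [small_mod] applies. *)
have s1_lt g : `|s1 g - s2 g| < p%:Z.
  apply: le_lt_trans (ler_normB _ _) _; apply: le_lt_trans a_lt.
  rewrite [leRHS](reindex_inj (act_inj to g)) [leRHS](bigID (mem O1)) /=.
  by apply: lerD; apply: ler_norm_sum.
have s1_const g : s1 g = s1 1%g.
  apply/eqP; rewrite -subr_eq0; apply/eqP/small_mod; last first.
    apply: (mulfI nz_c); rewrite mulr0 intrB mulrBr.
    apply/eqP; rewrite subr_eq0; apply/eqP/(addIr (psi y0 * s%:~R)).
    by rewrite !rel.
  rewrite -(@ltr_pM2l _ 2) //.
  have -> : 2 * `|s1 g - s1 1%g| = `|(s1 g - s2 g) - (s1 1%g - s2 1%g)|.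
    have D h : s2 h = s - s1 h by rewrite -(s12 h) addrC addKr.
    by rewrite !D -{1}(ger0_norm (ler0n int 2)) -normrM; congr `|_|; ring.
  apply: le_lt_trans (ler_normB _ _) _.
  by rewrite mulr2n mulrDl mul1r ltrD.
(* With [s1] constant, averaging gives [s1 1 * #|G| * 2p^m = s * p^m * #|G|], whence
   [s = 2 * s1 1]. *)
have := sum_transitive a O1 trG.
rewrite (eq_bigr _ (fun g _ => s1_const g)) sumr_const T_card card_orb -/s => E.
have {}E : s1 1%g *+ 2 *+ (p ^ m * #|[set: gT]|) = s *+ (p ^ m * #|[set: gT]|).
  by rewrite -E -!mulrnA; congr (_ *+ _); rewrite mulnA mulnC.
have /pmulrnI/(_ _ _ E) sE : (0 < p ^ m * #|[set: gT]|)%N.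
  by rewrite muln_gt0 cardG_gt0 expn_gt0 (prime_gt0 p_pr).
by case/negP: s_odd; rewrite -/s -sE -[_ *+ 2]mulr_natr dvdz_mull.
Qed.

(** * Galois action on the roots *)

Lemma minPoly1_root_irr (L : fieldExtType rat) (f : {poly rat}) (x y : L) :
  irreducible_poly f -> root (map_poly (in_alg L) f) x ->
  root (map_poly (in_alg L) f) y -> root (minPoly 1 x) y.
Proof.
move=> [_ irr_f] fx0 fy0.
have f1 : map_poly (in_alg L) f \is a polyOver 1%AS.
  by apply/polyOver1P; exists f.
have /polyOver1P[q Dq] := minPolyOver 1 x.
have qf : q %| f by rewrite -(dvdp_map (in_alg L)) -Dq minPoly_dvdp.
have q_neq1 : size q != 1.
  by rewrite -(size_map_poly (in_alg L)) -Dq size_minPoly eqSS -lt0n.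
by rewrite Dq (@eqp_root _ _ (map_poly (in_alg L) f)) // eqp_map irr_f.
Qed.

(** The group is the Galois group of the splitting field of [f], acting on indices of roots. It is
    transitive because all roots share one minimal polynomial, and its automorphisms fix integer
    coefficients. *)
Lemma conjugates_action (f : {poly rat}) (d : nat) (alpha : 'I_d -> algC) :
  irreducible_poly f -> lists_roots f alpha ->
  exists (gT : finGroupType) (to : {action gT &-> 'I_d}),
    (forall i j, exists g, to i g = j) /\
    (forall a : 'I_d -> int, \sum_j (a j)%:~R * alpha j = 0 ->
       forall g, \sum_j (a j)%:~R * alpha (to j g) = 0).
Proof.
move=> irr_f [alpha_inj alphaP].
have nz_f := irredp_neq0 irr_f.
have [r Dr] := closed_field_poly_normal (map_poly ratr f : {poly algC}).
have nz_lc : lead_coef (map_poly ratr f : {poly algC}) != 0.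
  by rewrite lead_coef_eq0 map_poly_eq0.
have [L0 [LC0 [s Ds genL]]] := num_field_exists r.
have LCalg (L : fieldExtType rat) (LC : {rmorphism L -> algC}) (q : {poly rat}) :
    map_poly LC (map_poly (in_alg L) q) = map_poly ratr q.
  rewrite -map_poly_comp; apply: eq_map_poly => c.
  by rewrite /= rmorphZ_num rmorph1 mulr1.
(* [L0] is generated by the preimages [s] of the roots, so it is a splitting field of [f] and has a
   Galois group. *)
have splitL : SplittingField.axiom L0.
  exists (map_poly (in_alg L0) f); first by apply/polyOver1P; exists f.
  exists s => //; rewrite -(eqp_map LC0) LCalg Dr -Ds big_map rmorph_prod /=.
  under [X in _ %= X]eq_bigr do rewrite map_polyXsubC.
  exact: eqp_scale.
pose Lmix := FieldExt_isSplittingField.Build rat L0 splitL.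
pose L : splittingFieldType rat := HB.pack L0 Lmix.
pose LC : {rmorphism L -> algC} := LC0.
have betaP j : exists b : L, LC b == alpha j.
  have : alpha j \in r.
    rewrite -root_prod_XsubC -(rootZ _ _ nz_lc) -Dr.
    by apply/alphaP; exists j.
  by rewrite -Ds => /mapP[b _ ->]; exists b.
pose beta j := sval (sigW (betaP j)).
have betaE j : LC (beta j) = alpha j by rewrite /beta; case: sigW => b /= /eqP.
have fbeta j : root (map_poly (in_alg L) f) (beta j).
  by rewrite -(fmorph_root LC) LCalg betaE; apply/alphaP; exists j.
have fgal (g : gal_of {:L}) x : root (map_poly (in_alg L) f) x ->
    root (map_poly (in_alg L) f) (g x).
  move=> fx0; have -> : map_poly (in_alg L) f = map_poly g (map_poly (in_alg L) f).
    rewrite -map_poly_comp; apply: eq_map_poly => c.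
    by rewrite /= linearZ /= rmorph1.
  by rewrite fmorph_root.
have actP j (g : gal_of {:L}) : exists k, alpha k == LC (g (beta j)).
  have /alphaP[k Dk] : root (map_poly ratr f) (LC (g (beta j))).
    by rewrite -(LCalg _ LC) fmorph_root fgal.
  by exists k; apply/eqP.
pose act j g := sval (sigW (actP j g)).
have actE j g : beta (act j g) = g (beta j).
  by apply: (fmorph_inj LC); rewrite betaE /act; case: sigW => k /= /eqP.
have beta_inj : injective beta.
  by move=> i j Eij; apply: alpha_inj; rewrite -!betaE Eij.
have act1 : act^~ 1%g =1 id by move=> j; apply: beta_inj; rewrite actE gal_id.
have actM j : act_morph act j.
  by move=> g h; apply: beta_inj; rewrite !actE galM ?memvf.
exists (gal_of {:L}), (TotalAction act1 actM); split=> [i j | a Da g] /=.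
  have nL : normalField 1 {:L} by apply: normalFieldf.
  have [g _ Dg] := normalField_root_minPoly (sub1v _) nL (memvf _)
                     (minPoly1_root_irr irr_f (fbeta i) (fbeta j)).
  by exists g; apply: beta_inj; rewrite actE.
have : \sum_j (a j)%:~R * beta j = 0.
  apply: (fmorph_inj LC); rewrite rmorph0 rmorph_sum -[RHS]Da.
  by apply: eq_bigr => j _; rewrite rmorphM rmorph_int betaE.
move/(congr1 (LC \o g)); rewrite /= !rmorph0 !rmorph_sum => E; rewrite -[RHS]E.
apply: eq_bigr => j _.
by rewrite -betaE actE !rmorphM /= !rmorph_int.
Qed.

(** * From complex relations to relations mod p *)

Lemma rational_functional (d : nat) (alpha : 'I_d -> algC) (i : 'I_d) :
  alpha i != 0 ->
  exists2 q : 'I_d -> rat, q i != 0 &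
    forall a : 'I_d -> int, \sum_j (a j)%:~R * alpha j = 0 ->
      \sum_j (a j)%:~R * q j = 0.
Proof.
move=> nz_i; have [L [LC [s Ds _]]] := num_field_exists (codom alpha).
have betaP j : exists b : L, LC b == alpha j.
  have : alpha j \in codom alpha by apply: codom_f.
  by rewrite -Ds => /mapP[b _ ->]; exists b.
pose beta j := sval (sigW (betaP j)).
have betaE j : LC (beta j) = alpha j by rewrite /beta; case: sigW => b /= /eqP.
pose e := vbasis {:L}.
(* The functional is a coordinate in a rational basis of a number field containing all [alpha j],
   chosen not to vanish at [alpha i]. *)
have [k nz_k] : exists k, coord e k (beta i) != 0.
  apply/existsP; apply: contraNT nz_i => /existsPn E0.
  rewrite -betaE (coord_vbasis (memvf (beta i))) big1 ?rmorph0 // => k _.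
  by have /negPn/eqP-> := E0 k; rewrite scale0r.
exists (fun j => coord e k (beta j)) => // a Da.
have : \sum_j (a j)%:~R *: beta j = 0.
  apply: (fmorph_inj LC); rewrite rmorph0 rmorph_sum -[RHS]Da.
  by apply: eq_bigr => j _; rewrite rmorphZ_num ratr_int betaE.
move/(congr1 (coord e k)); rewrite !linear0 linear_sum => E; rewrite -[RHS]E.
by apply: eq_bigr => j _; rewrite linearZ.
Qed.

Lemma Fp_functional (p d : nat) (q : 'I_d -> rat) (i : 'I_d) :
  prime p -> q i != 0 ->
  exists2 phi : {ffun 'I_d -> 'F_p}, phi != 0 &
    forall a : 'I_d -> int, \sum_j (a j)%:~R * q j = 0 ->
      \sum_j (a j)%:~R * phi j = 0.
Proof.
move=> p_pr nz_i.
(* The vector [q] is stored as coefficients of a polynomial to use contents and primitive parts; the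
   default 0 is never reached for [j < d]. *)
pose P := \poly_(j < d) (if insub j is Some k then q k else 0).
have PE (j : 'I_d) : P`_j = q j by rewrite coef_poly ltn_ord valK.
have [Q [c nz_c DP]] := rat_poly_scale P.
pose R := zprimitive Q.
have nz_Q : Q != 0.
  apply: contraNneq nz_i => Q0; rewrite -PE DP Q0.
  by rewrite rmorph0 scaler0 coef0.
pose b : rat := c%:~R^-1 * (zcontents Q)%:~R.
have nz_b : b != 0 by rewrite mulf_neq0 ?invr_eq0 ?intr_eq0 ?zcontents_eq0.
have qE j : q j = b * (R`_j)%:~R.
  by rewrite -PE DP [Q in LHS]zpolyEprim coefZ coef_map coefZ /= intrM mulrA.
have chp := pchar_Fp p_pr.
exists [ffun j : 'I_d => (R`_j)%:~R] => [|a Da].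
  (* Otherwise p would divide every coefficient of the primitive polynomial [R], whose content is
     1. *)
  apply/eqP=> phi0; have : (p %| zcontents R)%Z.
    rewrite dvdz_contents; apply/polyOverP=> j.
    change (is_true (p %| R`_j)%Z).
    have [ltjd | ledj] := ltnP j d.
      rewrite (dvdz_pcharf chp); move/ffunP/(_ (Ordinal ltjd)): phi0.
      by rewrite !ffunE /= => ->.
    rewrite nth_default ?dvdz0 // size_zprimitive (leq_trans _ ledj) //.
    have := size_poly d (fun j => if insub j is Some k then q k else 0).
    rewrite -/P DP size_scale ?invr_eq0 ?intr_eq0 //.
    by rewrite size_map_poly_id0 // intr_eq0 lead_coef_eq0.
  rewrite zcontents_primitive nz_Q => /=.
  by rewrite dvdzE /= dvdn1; apply/negP; rewrite neq_ltn prime_gt1 ?orbT.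
have : \sum_j a j * R`_j = 0.
  apply/eqP; rewrite -(intr_eq0 rat) rmorph_sum -(mulrI_eq0 _ (mulfI nz_b)).
  rewrite mulr_sumr -[X in _ == X]Da; apply/eqP/eq_bigr => j _.
  by rewrite rmorphM qE mulrCA.
move/(congr1 (intr : int -> 'F_p)); rewrite rmorph0 rmorph_sum => E.
by rewrite -[RHS]E; apply: eq_bigr => j _; rewrite ffunE rmorphM.
Qed.

Theorem theorem4 (p m : nat) (f : {poly rat}) (alpha : 'I_(2 * p ^ m) -> algC)
    (p_prime : prime p) (p_ge3 : (3 <= p)%N) (m_ge1 : (1 <= m)%N)
    (f_irr : irreducible_poly f) (f_deg : size f = (2 * p ^ m).+1)
    (f_roots : lists_roots f alpha)
    (a : 'I_(2 * p ^ m) -> int)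
    (a_rel : \sum_j (a j)%:~R * alpha j = 0)
    (a_small : \sum_j `|a j| < p%:Z) :
  (2 %| \sum_j a j)%Z.
Proof.
(* There are at least two distinct roots, so they are not all 0. *)
have nz_root : exists i, alpha i != 0.
  have d_gt1 : (1 < 2 * p ^ m)%N by rewrite leq_pmulr // expn_gt0 prime_gt0.
  pose i := Ordinal (ltnW d_gt1); pose j := Ordinal d_gt1.
  have [ai0 | ] := eqVneq (alpha i) 0; last by exists i.
  exists j; apply/eqP=> aj0; have [alpha_inj _] := f_roots.
  by have /(congr1 val) := alpha_inj i j (etrans ai0 (esym aj0)).
have [i nz_i] := nz_root.
have [q nz_q q_rel] := rational_functional nz_i.
have [phi nz_phi phi_rel] := Fp_functional p_prime nz_q.
have [gT [to [trG to_rel]]] := conjugates_action f_irr f_roots.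
apply: (even_sum_of_annihilator (to := to) p_prime p_ge3 (card_ord _) _ nz_phi) => //.
  apply/imsetP; exists i => //; apply/esym/setP=> j; rewrite inE.
  by have [g <-] := trG i j; apply: mem_orbit.
move=> g; apply: phi_rel (fun x => a (to x g)) _.
apply: q_rel (fun x => a (to x g)) _.
(* Translating [a] by [g] amounts to applying the inverse of [g] to the roots. *)
rewrite -[RHS](to_rel a a_rel g^-1%g) [RHS](reindex_inj (act_inj to g)).
by apply: eq_bigr => j _; rewrite actK.
Qed.
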